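(* Let $n,d\ge 1$, $a<b$ be reals, $p\in\{1,2\}$ and $\varepsilon\in(0,1)$. Let $\mathcal{D}=\prod_{i=1}^d\mathcal{D}_i$ be an arbitrary product distribution on $[n]^d$. There is an $L_p$-tester for monotonicity of functions $f:[n]^d\to[a,b]$ with respect to $\mathcal{D}$ and proximity parameter $\varepsilon$ whose time complexity is $O\!\left(\frac{d}{\varepsilon^p}\log\frac{d}{\varepsilon^p}\right)$.
   Context: A function $f:[n]^d\to\mathbb{R}$ is monotone if $f(x)\le f(y)$ whenever $x_i\le y_i$ for all $i$. For functions with range $[a,b]$ put $r=b-a$. The $L_p$-distance of $f$ from a property (set of functions) $\mathcal{P}$ with respect to a distribution $\mathcal{D}$ is $d_{\mathcal{P}}(f)=\frac1r\inf_{g\in\mathcal{P}}\left(\mathbf{E}_{x\sim\mathcal{D}}[|f(x)-g(x)|^p]\right)^{\min\{1/p,1\}}$. An $L_p$-tester for $\mathcal{P}$ with respect to $\mathcal{D}$ with proximity parameter $\varepsilon$ is a randomized algorithm that has query access to $f$ (and may sample points from $\mathcal{D}$), accepts with probability at least $2/3$ if $f\in\mathcal{P}$, and rejects with probability at least $2/3$ if $d_{\mathcal{P}}(f)>\varepsilon$. *)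

(* Defs.v *)
From HB Require Import structures.
From mathcomp Require Import all_boot all_order all_algebra.
From mathcomp Require Import all_classical all_reals all_analysis.

Set Implicit Arguments.
Unset Strict Implicit.
Unset Printing Implicit Defensive.

Import Order.TTheory GRing.Theory Num.Theory.

Local Open Scope classical_set_scope.
Local Open Scope ring_scope.

(* The hypergrid [n]^d, with [n] indexed from 0. *)
Definition grid (n d : nat) := {ffun 'I_d -> 'I_n}.

Section Distances.
Variables (R : realType) (n d : nat).

Definition monotone_fun : set (grid n d -> R) :=
  [set f | forall x y : grid n d, (forall i, (x i <= y i)%N) -> f x <= f y].

Definition is_dist (T : finType) (mu : T -> R) : Prop :=
  (forall x, 0 <= mu x) /\ \sum_x mu x = 1.

Definition prod_dist (Di : 'I_d -> 'I_n -> R) (x : grid n d) : R :=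
  \prod_(i < d) Di i (x i).

Definition expect (D F : grid n d -> R) : R := \sum_x D x * F x.

Definition Lp_dist (a b p : R) (D : grid n d -> R)
    (P : set (grid n d -> R)) (f : grid n d -> R) : R :=
  (b - a)^-1 *
  inf [set expect D (fun x => `|f x - g x| `^ p) `^ Num.min p^-1 1 | g in P].

End Distances.

(* Randomized algorithms with sample access to D and query access to f: the
   unrolled executions of a unit-cost real RAM.  The memory consists of natural
   number, real and grid point registers, and data can be acted upon only
   through the elementary operations below; in particular the control flow
   depends on data only through comparisons of two registers.  Operands are
   register numbers, the destination comes first. *)
Inductive real_op := Radd | Rsub | Rmul | Rdiv.

Inductive instr (R : Type) :=
| Sample of nat                    (* point <- fresh draw from D *)
| Query of nat & nat               (* real <- f point *)
| Rand of nat & nat                (* Rand i k : nat i <- uniform on {0..k} *)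
| CopyPt of nat & nat
| GetCoord of nat & nat & nat      (* nat i <- (point q)_(nat j) *)
| SetCoord of nat & nat & nat      (* (point q)_(nat j) <- nat i *)
| NatConst of nat & nat
| NatAdd of nat & nat & nat
| NatSub of nat & nat & nat        (* truncated *)
| RealConst of nat & R
| RealOp of real_op & nat & nat & nat
| RealOfNat of nat & nat.

Inductive test := NatLe of nat & nat | RealLe of nat & nat.

(* Halt true accepts, Halt false rejects. *)
Inductive prog (R : Type) :=
| Halt of bool
| Do of instr R & prog R
| If of test & prog R & prog R.

(* Worst-case number of operations (instructions and tests) performed before
   halting. *)
Fixpoint time (R : Type) (c : prog R) : nat :=
  match c with
  | Halt _ => 0
  | Do _ c => (time c).+1
  | If _ c1 c2 => (maxn (time c1) (time c2)).+1
  end.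

Section Semantics.
Variables (R : realType) (n d : nat).

Record state := State {
  nreg : nat -> nat;
  rreg : nat -> R;
  preg : nat -> grid n d }.

Definition upd (T : Type) (m : nat -> T) (k : nat) (v : T) : nat -> T :=
  fun i => if i == k then v else m i.

Definition set_nreg s k v := State (upd (nreg s) k v) (rreg s) (preg s).
Definition set_rreg s k v := State (nreg s) (upd (rreg s) k v) (preg s).
Definition set_preg s k v := State (nreg s) (rreg s) (upd (preg s) k v).

Definition init_state (n_gt0 : (0 < n)%N) : state :=
  State (fun=> 0%N) (fun=> 0) (fun=> [ffun=> Ordinal n_gt0]).

Definition eval_op (o : real_op) (x y : R) : R :=
  match o with
  | Radd => x + y
  | Rsub => x - y
  | Rmul => x * y
  | Rdiv => x / y
  end.

(* Out-of-range coordinate accesses have no effect. *)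
Definition get_coord (s : state) (i q j : nat) : state :=
  if insub (nreg s j) is Some jd then set_nreg s i (preg s q jd) else s.

Definition set_coord (s : state) (q j i : nat) : state :=
  if (insub (nreg s j), insub (nreg s i)) is (Some jd, Some v) then
    set_preg s q [ffun k : 'I_d => if k == jd then v else preg s q k]
  else s.

Definition eval_test (s : state) (t : test) : bool :=
  match t with
  | NatLe i j => (nreg s i <= nreg s j)%N
  | RealLe i j => rreg s i <= rreg s j
  end.

Variables (D f : grid n d -> R).

(* [step o s K] is the expectation of K over the state reached from s by
   executing o. *)
Definition step (o : instr R) (s : state) (K : state -> R) : R :=
  match o with
  | Sample q => \sum_x D x * K (set_preg s q x)
  | Query x q => K (set_rreg s x (f (preg s q)))
  | Rand i k => \sum_(v < k.+1) (k.+1%:R)^-1 * K (set_nreg s i v)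
  | CopyPt q q' => K (set_preg s q (preg s q'))
  | GetCoord i q j => K (get_coord s i q j)
  | SetCoord q j i => K (set_coord s q j i)
  | NatConst i v => K (set_nreg s i v)
  | NatAdd i j k => K (set_nreg s i (nreg s j + nreg s k)%N)
  | NatSub i j k => K (set_nreg s i (nreg s j - nreg s k)%N)
  | RealConst x v => K (set_rreg s x v)
  | RealOp r x y z => K (set_rreg s x (eval_op r (rreg s y) (rreg s z)))
  | RealOfNat x i => K (set_rreg s x (nreg s i)%:R)
  end.

Fixpoint prob_from (out : bool) (c : prog R) (s : state) : R :=
  match c with
  | Halt b => (b == out)%:R
  | Do o c => step o s (prob_from out c)
  | If t c1 c2 =>
      if eval_test s t then prob_from out c1 s else prob_from out c2 s
  end.

Definition prob_output (n_gt0 : (0 < n)%N) (out : bool) (c : prog R) : R :=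
  prob_from out c (init_state n_gt0).

End Semantics.

Definition Lp_tester (R : realType) (n d : nat) (n_gt0 : (0 < n)%N)
    (a b p eps : R) (D : grid n d -> R) (P : set (grid n d -> R))
    (c : prog R) : Prop :=
  forall f : grid n d -> R, (forall x, a <= f x <= b) ->
    (P f -> 2 / 3 <= prob_output D f n_gt0 true c) /\
    (eps < Lp_dist a b p D P f -> 2 / 3 <= prob_output D f n_gt0 false c).

(* Main.v *)
Require Import Defs.
From HB Require Import structures.
From mathcomp Require Import all_boot all_order all_algebra.
From mathcomp Require Import all_classical all_reals all_analysis.
From mathcomp Require Import ring lra zify.

Set Implicit Arguments.
Unset Strict Implicit.
Unset Printing Implicit Defensive.

Import Order.TTheory GRing.Theory Num.Theory.

Local Open Scope ring_scope.

(* Since |f - g|^p <= (b - a)^(p - 1) |f - g| on [a, b], it suffices to test in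
   L1 with parameter delta = eps^p; if delta >= 1/2 the constant (a + b) / 2 is
   close enough to every f and the tester accepts without looking.

   A random threshold reduces to Boolean functions: f is the average of its
   threshold functions.  If h is, along each direction i, at distance Delta_i
   from a function monotone along i, then h is at distance at most
   2 sum_i Delta_i from a monotone function.  To see it, apply isotonic
   regression along one direction after the other; it is an L1-contraction that
   fixes monotone functions and preserves monotonicity along the other
   directions.  Hence a random axis-parallel line of a random threshold function
   is at mean distance at least mu = delta / (4 d) from monotone.

   A Boolean line at distance alpha has a cut with weight alpha / 2 of ones
   below and alpha / 2 of zeros above, so O(1 / alpha) samples of the line
   reveal a violation, seen by comparing the least one with the greatest zero (no
   sorting, so the time is linear).  With M = O(1 / mu) rounds, round r taking
   O(M / r) samples of a fresh line, the expected number of rounds able to catch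
   a random line is at least M mu - 1, and the total time is
   O(M (1 + 1/2 + ... + 1/M)) = O(M log M). *)

(** * Weighted isotonic regression of a sequence *)

Section Rearrangement.
Variable R : realType.
Implicit Types (w g h u v : nat -> R).

(** The level [c g] is the greatest weighted average of [g] over the index [n] pooled with a set [A]
    of earlier indices. A maximum of averages increases with [g], and maximality forces the mass
    balance. *)
Lemma pool_level w n : (forall k, 0 <= w k) ->
  exists c : (nat -> R) -> R, [/\
    forall g h, (forall k, (k <= n)%N -> g k <= h k) -> c g <= c h,
    forall g, \sum_(k < n) w k * (g k - Num.min (g k) (c g)) =
              w n * (c g - g n) &
    forall g, (forall k, (k <= n)%N -> g k <= g n) -> c g = g n].
Proof.
move=> w0; have [wn0|wn0] := eqVneq (w n) 0.
  (* With [w n = 0] averages may divide by zero; the overall maximum cuts nothing off, so both sides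
     of the balance vanish. *)
  exists (fun g => \big[Num.max/g n]_(k < n) g k); split.
  - move=> g h gh; apply/bigmax_leP; split=> [|i _].
      by apply: le_trans (gh n _) _ => //; apply: bigmax_ge_id.
    apply: le_trans (gh i _) _; first by rewrite ltnW.
    exact: (le_bigmax _ (fun k : 'I_n => h k)).
  - move=> g; rewrite wn0 mul0r big1 // => i _.
    by rewrite min_l ?subrr ?mulr0 //; apply: (le_bigmax _ (fun k : 'I_n => g k)).
  - move=> g gn; apply/le_anti/andP; split; last exact: bigmax_ge_id.
    by apply/bigmax_leP; split=> // i _; apply: gn; rewrite ltnW.
have wn : 0 < w n by rewrite lt_def wn0 w0.
pose W (A : {set 'I_n}) := \sum_(k in A) w k + w n.
pose avg g (A : {set 'I_n}) := (\sum_(k in A) w k * g k + w n * g n) / W A.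
have W0 A : 0 < W A by rewrite ltr_wpDl // sumr_ge0.
have avgE g (A : {set 'I_n}) (c : R) :
    \sum_(k in A) w k * (g k - c) + w n * (g n - c) =
    (avg g A - c) * W A.
  rewrite mulrBl /avg divfK ?gt_eqF // [c * _]mulrDr mulr_sumr.
  under eq_bigr do rewrite mulrBr.
  rewrite sumrB; under [X in _ - X + _]eq_bigr do rewrite mulrC.
  ring.
exists (fun g => avg g [arg max_(A > finset.set0) avg g A]%O); split.
- move=> g h gh; case: arg_maxP => // A _ _; case: arg_maxP => // B _ Bmax.
  apply: le_trans (Bmax A isT); rewrite /avg ler_pM2r ?invr_gt0 //.
  apply: lerD; last by rewrite ler_wpM2l // gh.
  by apply: ler_sum => k _; rewrite ler_wpM2l // gh // ltnW.
- move=> g; case: arg_maxP => // A _ Amax; set c := avg g A.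
  have eq0 : \sum_(k in A) w k * (g k - c) + w n * (g n - c) = 0.
    by rewrite avgE subrr mul0r.
  (* [P] gathers every positive excess over [c], so its total is at least that of [A], which is
     zero; maximality of [A] gives the converse. *)
  pose P := [set k : 'I_n | c < g k]%SET.
  have leP0 : \sum_(k in P) w k * (g k - c) + w n * (g n - c) <= 0.
    by rewrite avgE pmulr_lle0 // subr_le0; exact: Amax.
  have sumP : \sum_(k < n) w k * (g k - Num.min (g k) c) =
              \sum_(k in P) w k * (g k - c).
    rewrite [RHS]big_mkcond; apply: eq_bigr => k _; rewrite inE.
    by case: ltP => ck; rewrite ?subrr ?mulr0.
  have AP : \sum_(k in A) w k * (g k - c) <=
            \sum_(k < n) w k * (g k - Num.min (g k) c).
    rewrite big_mkcond; apply: ler_sum => k _.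
    case: ifP => _; first by rewrite ler_wpM2l // lerB // ge_min lexx orbT.
    by rewrite mulr_ge0 // subr_ge0 ge_min lexx.
  rewrite sumP in AP *; lra.
- move=> g gn; case: arg_maxP => // A _ Amax; apply/le_anti/andP; split.
    rewrite -subr_le0 -(pmulr_lle0 _ (W0 A)) -avgE subrr mulr0 addr0.
    by rewrite sumr_le0 // => k _; rewrite mulr_ge0_le0 // subr_le0 gn // ltnW.
  apply: le_trans (Amax finset.set0 isT).
  by rewrite /avg /W !big_set0 !add0r mulrC mulKf.
Qed.

(* Weighted isotonic regression by pool-adjacent-violators: the last value is
   merged into the already rearranged prefix at the level where the mass cut
   off from above is the mass it needs. *)
Lemma isotonic_rearrangement w n : (forall k, 0 <= w k) ->
  exists S : (nat -> R) -> nat -> R, [/\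
    forall u i j, (i <= j < n)%N -> S u i <= S u j,
    forall u v, (forall k, (k < n)%N -> u k <= v k) ->
      forall k, (k < n)%N -> S u k <= S v k,
    forall u, \sum_(k < n) w k * S u k = \sum_(k < n) w k * u k &
    forall u, (forall i j, (i <= j < n)%N -> u i <= u j) ->
      forall k, (k < n)%N -> S u k = u k].
Proof.
move=> w0; elim: n => [|n [S [Smono Sle Smean Sfix]]].
  exists (fun u => u); split=> // u i j; first by rewrite ltn0 andbF.
have [c [cle ceq cfix]] := pool_level n w0.
pose g u k := if (k < n)%N then S u k else u n.
pose T u k := if (k < n)%N then Num.min (S u k) (c (g u)) else c (g u).
have Tle u v : (forall k, (k < n.+1)%N -> u k <= v k) ->
    forall k, (k < n.+1)%N -> T u k <= T v k.
  move=> uv k kn.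
  have cuv : c (g u) <= c (g v).
    apply: cle => l ln; rewrite /g; case: ifP => // ltln; last exact: uv.
    by apply: Sle => // m mn; apply: uv; rewrite ltnW.
  rewrite /T; case: ifP => // ltkn; apply: le_min2 => //.
  by apply: Sle => // m mn; apply: uv; rewrite ltnW.
exists T; split=> //.
- move=> u i j /andP[ij jn]; rewrite /T; case: (ltnP j n) => jn'; last first.
    by case: ifP => // _; rewrite ge_min lexx orbT.
  by rewrite (leq_ltn_trans ij jn'); apply: le_min2 => //; apply: Smono; rewrite ij.
- move=> u; rewrite !big_ord_recr /= -(Smean u).
  have Tn : T u n = c (g u) by rewrite /T ltnn.
  have gE (k : 'I_n) : g u k = S u k by rewrite /g ltn_ord.
  have gn : g u n = u n by rewrite /g ltnn.
  have E : \sum_(k < n) w k * S u k - \sum_(k < n) w k * T u k =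
           w n * (c (g u) - u n).
    rewrite -gn -ceq -sumrB; apply: eq_bigr => k _.
    by rewrite /T ltn_ord gE mulrBr.
  rewrite Tn; lra.
- move=> u um.
  have um' k : (k < n)%N -> S u k = u k.
    by apply: Sfix => i j /andP[ij jn]; apply: um; rewrite ij ltnW.
  have cE : c (g u) = u n.
    rewrite cfix /g ltnn // => k kn; case: ifP => // kn'.
    by rewrite um' // um // ltnW //= .
  move=> k kn; rewrite /T cE; case: ifP => kn'.
    by rewrite um' // min_l // um // ltnW //=.
  by congr u; lia.
Qed.

End Rearrangement.

(** * Axis-parallel lines of the grid *)

Definition subst_coord (n d : nat) (x : grid n d) (i : 'I_d) (k : 'I_n) :
    grid n d :=
  [ffun j => if j == i then k else x j].

Section Grid.
Variables (n d : nat).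
Implicit Types (x y : grid n d) (i j : 'I_d) (k l : 'I_n).

Lemma subst_coord_same x i k : subst_coord x i k i = k.
Proof. by rewrite ffunE eqxx. Qed.

Lemma subst_coord_neq x i j k : j != i -> subst_coord x i k j = x j.
Proof. by rewrite ffunE => /negPf ->. Qed.

Lemma subst_coord_id x i : subst_coord x i (x i) = x.
Proof. by apply/ffunP => j; rewrite ffunE; case: eqP => // ->. Qed.

Lemma subst_coord2 x i k l :
  subst_coord (subst_coord x i k) i l = subst_coord x i l.
Proof. by apply/ffunP => j; rewrite !ffunE; case: eqP. Qed.

Lemma subst_coordC x i j k l : i != j ->
  subst_coord (subst_coord x i k) j l = subst_coord (subst_coord x j l) i k.
Proof.
move=> ij; apply/ffunP => m; rewrite !ffunE.
by case: eqVneq => // ->; rewrite eq_sym (negPf ij).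
Qed.

End Grid.

Definition monotone_along (R : realType) (n d : nat) (i : 'I_d)
    (f : grid n d -> R) : Prop :=
  forall x (k l : 'I_n), (k <= l)%N ->
    f (subst_coord x i k) <= f (subst_coord x i l).

Lemma monotone_along_all (R : realType) (n d : nat) (f : grid n d -> R) :
  (forall i, monotone_along i f) -> monotone_fun f.
Proof.
move=> fm x y xy.
(* Hybrid points: [z m.+1] differs from [z m] at most in coordinate [m]. *)
pose z m : grid n d := [ffun j : 'I_d => if (j < m)%N then y j else x j].
have z0 : z 0%N = x by apply/ffunP => j; rewrite ffunE.
have zd : z d = y by apply/ffunP => j; rewrite ffunE ltn_ord.
suff: forall m, (m <= d)%N -> f x <= f (z m) by move/(_ d (leqnn d)); rewrite zd.
elim=> [|m IHm] md; first by rewrite z0.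
apply: le_trans (IHm (ltnW md)) _.
pose i := Ordinal md.
have -> : z m.+1 = subst_coord (z m) i (y i).
  apply/ffunP => j; rewrite !ffunE ltnS leq_eqVlt -(inj_eq val_inj) /=.
  by case: eqP => //= jm; congr (y _); apply: val_inj.
rewrite -[X in f X <= _](subst_coord_id _ i).
by apply: fm; rewrite ffunE ltnn.
Qed.

(** * Product distributions and monotonicity repair, direction by direction *)

Section Product.
Variables (R : realType) (n d : nat) (Di : 'I_d -> 'I_n -> R).
Hypothesis Di_dist : forall i, is_dist (Di i).
Local Notation D := (prod_dist Di).
Implicit Types (f g h : grid n d -> R) (x y : grid n d) (i j : 'I_d).

Lemma prod_dist_ge0 x : 0 <= D x.
Proof. by apply: prodr_ge0 => i _; case: (Di_dist i). Qed.

Lemma prod_dist_sum1 : \sum_x D x = 1.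
Proof.
rewrite -(bigA_distr_bigA Di) big1 // => i _; by case: (Di_dist i).
Qed.

Lemma prod_dist_subst x i k :
  D x * Di i k = D (subst_coord x i k) * Di i (x i).
Proof.
rewrite /prod_dist (bigD1 i) //= [in RHS](bigD1 i) //= subst_coord_same.
rewrite [in RHS](eq_bigr (fun j => Di j (x j))); last first.
  by move=> j ji; rewrite subst_coord_neq.
by rewrite mulrAC [RHS]mulrAC [Di i k * _]mulrC.
Qed.

(* Resampling one coordinate preserves a product distribution: exchanging the
   fresh value with the old one is a weight-preserving involution. *)
Lemma expect_resample i f :
  \sum_x D x * (\sum_k Di i k * f (subst_coord x i k)) = \sum_x D x * f x.
Proof.
have -> : \sum_x D x * f x = \sum_x \sum_k D x * Di i k * f x.
  apply: eq_bigr => x _; rewrite -mulr_suml -mulr_sumr.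
  by case: (Di_dist i) => _ ->; rewrite mulr1.
under eq_bigr => x _ do rewrite mulr_sumr.
rewrite !pair_big /=.
pose sw (q : grid n d * 'I_n) := (subst_coord q.1 i q.2, q.1 i).
have swK : involutive sw.
  by case=> x k; rewrite /sw /= subst_coord2 subst_coord_id subst_coord_same.
rewrite [RHS](reindex_inj (inv_inj swK)) /=.
by apply: eq_bigr => -[x k] _ /=; rewrite mulrA prod_dist_subst.
Qed.

Lemma expect_coord i (F : 'I_n -> R) :
  \sum_x D x * F (x i) = \sum_k Di i k * F k.
Proof.
rewrite -(expect_resample i (fun x => F (x i))).
under eq_bigr => x _ do
  (under eq_bigr => k _ do rewrite subst_coord_same).
by rewrite -mulr_suml prod_dist_sum1 mul1r.
Qed.

Definition L1_dist f g : R := \sum_x D x * `|f x - g x|.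

Lemma L1_dist_triangle f g h : L1_dist f h <= L1_dist f g + L1_dist g h.
Proof.
rewrite -big_split /=; apply: ler_sum => x _.
by rewrite -mulrDr ler_wpM2l ?prod_dist_ge0 // ler_distD.
Qed.

Lemma L1_distC f g : L1_dist f g = L1_dist g f.
Proof. by apply: eq_bigr => x _; rewrite distrC. Qed.

(** Isotonic regression is applied to each line in direction [i]. Resampling coordinate [i] reduces
    the mean to the means of lines. A function monotone along another [j] has pointwise ordered
    parallel lines, and regression preserves that order. *)
Lemma directional_rearrangement i :
  exists S : (grid n d -> R) -> grid n d -> R, [/\
    forall f, monotone_along i (S f),
    forall f g, (forall x, f x <= g x) -> forall x, S f x <= S g x,
    forall f, \sum_x D x * S f x = \sum_x D x * f x,
    forall f, monotone_along i f -> forall x, S f x = f x &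
    forall j f, monotone_along j f -> monotone_along j (S f)].
Proof.
pose ext (F : 'I_n -> R) k := if insub k is Some l then F l else 0.
have extE F (k : 'I_n) : ext F k = F k by rewrite /ext valK.
have w0 k : 0 <= ext (Di i) k.
  by rewrite /ext; case: insub => // l; case: (Di_dist i).
have [S [Smono Sle Smean Sfix]] := isotonic_rearrangement n w0.
pose line f x k := f (subst_coord x i k).
have lineS f x k : line f (subst_coord x i k) = line f x.
  by apply/funext => l; rewrite /line subst_coord2.
pose T f x := S (ext (line f x)) (x i).
have Tle f g x : (forall k, line f x k <= line g x k) -> T f x <= T g x.
  move=> fg; apply: Sle => // k kn.
  by rewrite -[k]/(val (Ordinal kn)) !extE.
have Tmono f : monotone_along i (T f).
  move=> x k l kl; rewrite /T !lineS !subst_coord_same.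
  by apply: Smono; rewrite kl /=.
exists T; split=> //.
- by move=> f g fg x; apply: Tle => k; apply: fg.
- move=> f; rewrite -(expect_resample i) -[RHS](expect_resample i).
  apply: eq_bigr => x _; congr (_ * _).
  under eq_bigr => k _ do rewrite /T lineS subst_coord_same -extE.
  by rewrite Smean; apply: eq_bigr => k _; rewrite !extE.
- move=> f fm x; rewrite /T Sfix // ?extE /line ?subst_coord_id //.
  move=> k l /andP[kl ln].
  rewrite -[k]/(val (Ordinal (leq_ltn_trans kl ln))) -[l]/(val (Ordinal ln)).
  by rewrite !extE; apply: fm.
- move=> j f fm; have [<-|ij] := eqVneq i j; first exact: Tmono.
  move=> x k l kl.
  rewrite /T !(subst_coord_neq _ _ ij); apply: Sle => // m mn.
  rewrite -[m]/(val (Ordinal mn)) !extE /line.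
  rewrite ![subst_coord (subst_coord x j _) _ _]subst_coordC 1?eq_sym //.
  exact: fm.
Qed.

(* Order and mean preservation make a rearrangement an L1-contraction
   (Crandall-Tartar): integrate [`|f - g| = 2 max f g - f - g]. *)
Lemma L1_contraction (S : (grid n d -> R) -> grid n d -> R) :
  (forall f g, (forall x, f x <= g x) -> forall x, S f x <= S g x) ->
  (forall f, \sum_x D x * S f x = \sum_x D x * f x) ->
  forall f g, L1_dist (S f) (S g) <= L1_dist f g.
Proof.
move=> Sle Smean f g.
pose m x := Num.max (f x) (g x).
have distE a b : `|a - b| = 2 * Num.max a b - a - b :> R.
  case: leP => ab; first by rewrite ler0_norm ?subr_le0 //; ring.
  by rewrite gtr0_norm ?subr_gt0 //; ring.
have sumE (u v M : grid n d -> R) :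
    \sum_x D x * (2 * M x - u x - v x) =
    2 * \sum_x D x * M x - \sum_x D x * u x - \sum_x D x * v x.
  by rewrite mulr_sumr -!sumrB; apply: eq_bigr => x _; ring.
have -> : L1_dist f g =
    2 * \sum_x D x * S m x - \sum_x D x * S f x - \sum_x D x * S g x.
  by rewrite !Smean -sumE; apply: eq_bigr => x _; rewrite distE.
rewrite -sumE; apply: ler_sum => x _; rewrite distE.
rewrite ler_wpM2l ?prod_dist_ge0 // !lerB // ler_wpM2l // ge_max !Sle //.
  by move=> y; rewrite /m le_max lexx orbT.
by move=> y; rewrite /m le_max lexx.
Qed.

(* Rearranging successively along each direction keeps every other [G j]
   monotone along [j] and, by contraction, as close to [f] as it was; a
   rearrangement moves [f] by at most twice its distance to a fixed point. *)
Lemma monotone_of_directions f (G : 'I_d -> grid n d -> R) :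
  (forall i, monotone_along i (G i)) ->
  exists2 g, monotone_fun g & L1_dist f g <= 2 * \sum_i L1_dist f (G i).
Proof.
suff H (s : seq 'I_d) : forall f G, (forall i, monotone_along i (G i)) ->
    exists g, [/\ forall i, i \in s -> monotone_along i g,
      forall i, monotone_along i f -> monotone_along i g &
      L1_dist f g <= 2 * \sum_(i <- s) L1_dist f (G i)].
  move=> Gm; have [g [gm _ fg]] := H (index_enum 'I_d) f G Gm.
  exists g => //; apply: monotone_along_all => i.
  by apply: gm; rewrite mem_index_enum.
elim: s => [|i s IHs] {}f {}G Gm.
  exists f; split=> //; rewrite big_nil mulr0 /L1_dist big1 // => x _.
  by rewrite subrr normr0 mulr0.
have [S [Smono Sle Smean Sfix Spres]] := directional_rearrangement i.
have Sctr := L1_contraction Sle Smean.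
have [g [gm gpres fg]] :=
  IHs (S f) (fun j => S (G j)) (fun j => Spres j _ (Gm j)).
exists g; split.
- move=> j; rewrite inE => /predU1P[->|]; last exact: gm.
  exact: gpres.
- by move=> j fj; apply: gpres; apply: Spres.
have fSf : L1_dist f (S f) <= 2 * L1_dist f (G i).
  apply: le_trans (L1_dist_triangle _ (G i) _) _.
  rewrite mulr2n mulrDl mul1r lerD2l L1_distC.
  have SG : S (G i) = G i by apply/funext => x; apply: Sfix.
  by rewrite -[X in L1_dist _ X <= _]SG Sctr.
apply: le_trans (L1_dist_triangle _ (S f) _) _.
rewrite big_cons mulrDr lerD //; apply: le_trans fg _.
by rewrite ler_wpM2l //; apply: ler_sum => j _; apply: Sctr.
Qed.

End Product.

(** * Distance of a Boolean line from step functions *)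

Section Cut.
Variables (R : realType) (n : nat) (w : 'I_n -> R) (u : 'I_n -> bool).
Hypothesis w_ge0 : forall k, 0 <= w k.

Definition cut_cost (K : nat) : R :=
  \sum_k w k * `|(u k)%:R - (K <= k)%:R|.

(** The range ['I_n.+1] includes the cut [n], that is, the constant zero function. *)
Definition best_cut : 'I_n.+1 := [arg min_(K < ord0) cut_cost K]%O.

Definition cut_dist : R := cut_cost best_cut.

Definition early_ones (K : nat) : R := \sum_(k | u k && (k < K)%N) w k.

Definition late_zeros (K : nat) : R := \sum_(k | ~~ u k && (K <= k)%N) w k.

Lemma cut_dist_le K : (K <= n)%N -> cut_dist <= cut_cost K.
Proof.
rewrite -ltnS => Kn; rewrite /cut_dist /best_cut.
by case: arg_minP => // L _ /(_ (Ordinal Kn) isT).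
Qed.

Lemma cut_costE K : cut_cost K = early_ones K + late_zeros K.
Proof.
rewrite /early_ones /late_zeros !(big_mkcond (fun _ => _ && _)) -big_split /=.
apply: eq_bigr => k _; case: (u k); case: leqP => _ /=;
by rewrite ?subrr ?subr0 ?sub0r ?normrN ?normr0 ?normr1 ?mulr0 ?mulr1 ?addr0 ?add0r.
Qed.

Lemma cut_dist_ge0 : 0 <= cut_dist.
Proof. by apply: sumr_ge0 => k _; rewrite mulr_ge0. Qed.

(** Take the least cut with enough early ones. One position earlier they weigh less than half the
    distance, so the late zeros weigh at least half; the position in between carries a one, so
    moving the cut past it loses no late zero. *)
Lemma cut_dist_split :
  exists K, cut_dist / 2 <= early_ones K /\ cut_dist / 2 <= late_zeros K.
Proof.
have d0 := cut_dist_ge0.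
have ex : exists K, cut_dist / 2 <= early_ones K.
  exists n; have := cut_dist_le (leqnn n); rewrite cut_costE.
  rewrite [late_zeros n]big1 ?addr0 => [|k]; first by lra.
  by rewrite leqNgt ltn_ord andbF.
case: (ex_minnP ex) => -[|K] HK Kmin.
  exists 0%N; split=> //; have e0 : early_ones 0 = 0.
    by rewrite /early_ones big1 // => k; rewrite ltn0 andbF.
  by apply: le_trans HK _; rewrite e0 sumr_ge0.
exists K.+1; split=> //.
have eK : early_ones K < cut_dist / 2.
  by rewrite ltNge; apply/negP => /Kmin; rewrite ltnn.
have Kn : (K < n)%N.
  rewrite ltnNge; apply/negP => nK; move: HK; rewrite leNgt => /negP; apply.
  rewrite (_ : early_ones K.+1 = early_ones K) //.
  by apply: eq_bigl => k; have := ltn_ord k; case: (u k) => //=; lia.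
pose k0 := Ordinal Kn.
have uK : u k0.
  apply/negPn/negP => uK; move: HK; rewrite leNgt => /negP; apply.
  rewrite (_ : early_ones K.+1 = early_ones K) //.
  apply: eq_bigl => k; have [->|kk] := eqVneq k k0; first by rewrite (negPf uK).
  have : (k != K :> nat) by apply: contraNneq kk => kK; apply/eqP/val_inj.
  by case: (u k) => //=; lia.
have -> : late_zeros K.+1 = late_zeros K.
  apply: eq_bigl => k; have [->|kk] := eqVneq k k0; first by rewrite uK.
  have : (k != K :> nat) by apply: contraNneq kk => kK; apply/eqP/val_inj.
  by case: (u k) => //=; lia.
have := cut_dist_le (ltnW Kn); rewrite cut_costE; lra.
Qed.

End Cut.

(** * Output probabilities and the program scanning one line *)

Section ProgramSemantics.
Variables (R : realType) (n d : nat) (D f : grid n d -> R).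
Hypothesis D_sum1 : \sum_x D x = 1.

Lemma prob_fromC (c : prog R) s :
  prob_from D f true c s + prob_from D f false c s = 1.
Proof.
elim: c s => [[]|o c IHc|t c1 IH1 c2 IH2] s /=; rewrite ?addr0 ?add0r //.
  case: o => /= [q|*|i k|*|*|*|*|*|*|*|*|*] //; rewrite -big_split /=.
    by under eq_bigr do rewrite -mulrDr IHc mulr1.
  under eq_bigr do rewrite -mulrDr IHc mulr1.
  by rewrite sumr_const card_ord -(mulr_natr (_^-1)) mulVf ?pnatr_eq0.
by case: ifP.
Qed.

End ProgramSemantics.

(* Register conventions: nat 0 is the direction of the line, nat 1 the least
   position of a point above the threshold, nat 2 the greatest position of a
   point below it, nat 3 the current position, nat 4 is kept at zero so that
   [NatAdd] can copy; point 0 runs over the line and real 0 is the threshold. *)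
Definition sample_point (R : Type) (c : prog R) : prog R :=
  Do (Sample R 1) (Do (GetCoord R 3 1 0) (Do (SetCoord R 0 0 3)
  (Do (Query R 1 0)
  (If (RealLe 0 1)
    (If (NatLe 1 3) c (Do (NatAdd R 1 3 4) c))
    (If (NatLe 3 2) c (Do (NatAdd R 2 3 4) c)))))).

(** The initial values [n] and [0] of nat 1 and nat 2 mean that nothing was seen: no one lies at
    [n], and a zero at position 0 violates nothing. Nat 5 and real 1 are scratch registers. *)
Definition line_round (R : realType) (n d' N' : nat) (a b : R) (q : nat)
    (c : prog R) : prog R :=
  Do (Sample R 0) (Do (Rand R 0 d') (Do (Rand R 5 N')
  (Do (RealOfNat R 0 5)
  (Do (RealConst 1 ((b - a) / N'.+1%:R)) (Do (RealOp R Rmul 0 0 1)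
  (Do (RealConst 1 a) (Do (RealOp R Radd 0 0 1)
  (Do (NatConst R 1 n) (Do (NatConst R 2 0) (Do (NatConst R 4 0)
  (iter q (@sample_point R) (If (NatLe 2 1) c (Halt R false))))))))))))).

(** Eleven set-up instructions and the final test give 12, and each sample costs 7. The continuation
    is copied into both branches of a test, but the maximum in [time] counts it once. *)
Lemma time_line_round (R : realType) n d' N' (a b : R) q c :
  (time (line_round n d' N' a b q c) <= 12 + 7 * q + time c)%N.
Proof.
rewrite /line_round /=.
have : (time (iter q (@sample_point R) (If (NatLe 2 1) c (Halt R false)))
  <= 1 + 7 * q + time c)%N.
  elim: q => [|q IHq] /=; first by rewrite maxn0 muln0 add1n.
  by move: IHq; set t := time _; lia.
by lia.
Qed.

(** * Expected effect of sampling a line *)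

Section Round.
Variables (R : realType) (n d' : nat).
Local Notation d := d'.+1.
Variables (Di : 'I_d -> 'I_n -> R) (f : grid n d -> R).
Hypothesis Di_dist : forall i, is_dist (Di i).
Local Notation D := (prod_dist Di).

(** This invariant mentions point 0 only through its line in direction [i], so it survives moves of
    the point along that line. *)
Definition scanning (s : state R n d) (i : 'I_d) (u : 'I_n -> bool)
    (lo hi : nat) : Prop :=
  [/\ nreg s 0 = i,
      forall k, (rreg s 0 <= f (subst_coord (preg s 0) i k)) = u k,
      nreg s 1 = lo, nreg s 2 = hi & nreg s 4 = 0%N].

(** Only coordinate [i] of the drawn point is used, and under a product distribution it follows
    [Di i]. *)
Lemma sample_point_le out c (i : 'I_d) u (F : nat -> nat -> R) :
  (forall s lo hi, scanning s i u lo hi -> prob_from D f out c s <= F lo hi) ->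
  forall s lo hi, scanning s i u lo hi ->
  prob_from D f out (sample_point c) s <=
  \sum_k Di i k * (if u k then F (minn lo k) hi else F lo (maxn hi k)).
Proof.
move=> cF s lo hi [s0 su slo shi s4].
rewrite -(expect_coord Di_dist i
  (fun k => if u k then F (minn lo k) hi else F lo (maxn hi k))).
apply: ler_sum => y _; rewrite ler_wpM2l ?prod_dist_ge0 //.
pose s1 := set_nreg (set_preg s 1 y) 3 (y i).
pose s2 := set_preg s1 0 (subst_coord (preg s 0) i (y i)).
have getE : get_coord (set_preg s 1 y) 3 1 0 = s1.
  by rewrite /get_coord [nreg _ _]s0 valK.
have setE : set_coord s1 0 0 3 = s2.
  by rewrite /set_coord [nreg _ 0]s0 (_ : nreg s1 3 = y i) // !valK.
rewrite /= getE setE.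
pose s3 := set_rreg s2 1 (f (subst_coord (preg s 0) i (y i))).
rewrite -[set_rreg _ _ _]/s3.
rewrite [rreg _ _ <= _]su [nreg s2 1]slo [nreg s2 2]shi [nreg s2 4]s4.
rewrite [nreg s2 3]/= addn0.
have su3 k : (rreg s 0 <= f (subst_coord (preg s3 0) i k)) = u k.
  by rewrite [preg s3 0]/= subst_coord2 su.
by case: ifP => uy; case: leqP => cmp; apply: cF; split=> //=.
Qed.

(** A supermartingale argument: [F m lo hi] is a potential for [m] remaining samples whose mean does
    not increase when one is drawn. *)
Lemma sample_points_le out c (i : 'I_d) u (F : nat -> nat -> nat -> R) :
  (forall s lo hi, scanning s i u lo hi ->
     prob_from D f out c s <= F 0%N lo hi) ->
  (forall m lo hi,
     \sum_k Di i k * (if u k then F m (minn lo k) hi else F m lo (maxn hi k))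
     <= F m.+1 lo hi) ->
  forall m s lo hi, scanning s i u lo hi ->
  prob_from D f out (iter m (@sample_point R) c) s <= F m lo hi.
Proof.
move=> F0 FS; elim=> [|m IHm] s lo hi sc; first exact: F0.
by rewrite iterS; apply: le_trans (FS m lo hi); apply: sample_point_le sc.
Qed.

End Round.

Section Counting.
Variable R : realType.
Implicit Types (z : R) (N : nat).

(** Serves to count both the thresholds below a value of [f] and the rounds able to catch a line. *)
Lemma count_le_ge z N : z <= N%:R -> z <= \sum_(v < N) (v%:R <= z)%R%:R.
Proof.
elim: N => [|N IHN] zN; first by rewrite big_ord0.
rewrite big_ord_recr /=; have [Nz|zN'] := leP (N%:R : R) z.
  rewrite (eq_bigr (fun=> 1)) => [|v _]; last first.
    by rewrite (le_trans _ Nz) // ler_nat ltnW.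
  by rewrite sumr_const card_ord natr1.
by rewrite addr0 IHN // ltW.
Qed.

Lemma count_le_le z N : 0 <= z -> \sum_(v < N) (v%:R <= z)%R%:R <= z + 1.
Proof.
move=> z0; elim: N => [|N IHN]; first by rewrite big_ord0 addr_ge0.
rewrite big_ord_recr /=; have [Nz|zN] := leP (N%:R : R) z; last by rewrite addr0.
rewrite lerD2r; apply: le_trans Nz.
rewrite -[X in _ <= X%:R]card_ord -sumr_const.
by apply: ler_sum => v _; rewrite lern1 leq_b1.
Qed.

End Counting.

(** * The tester: error bounds and distance of random lines *)

Section Tester.
Variables (R : realType) (n d' N' : nat) (a b : R).
Local Notation d := d'.+1.
Local Notation N := N'.+1.
Variables (Di : 'I_d -> 'I_n -> R) (f : grid n d -> R).
Hypothesis Di_dist : forall i, is_dist (Di i).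
Local Notation D := (prod_dist Di).

Definition above (v : 'I_N) (x : grid n d) : bool :=
  v%:R * ((b - a) / N%:R) + a <= f x.

Definition above_line x (i : 'I_d) v (k : 'I_n) : bool :=
  above v (subst_coord x i k).

Definition line_dist x (i : 'I_d) v : R := cut_dist (Di i) (above_line x i v).

Definition mean_line (F : grid n d -> 'I_d -> 'I_N -> R) : R :=
  \sum_x D x * (\sum_i d%:R^-1 * (\sum_v N%:R^-1 * F x i v)).

Lemma le_mean_line F G : (forall x i v, F x i v <= G x i v) ->
  mean_line F <= mean_line G.
Proof.
move=> FG; apply: ler_sum => x _; rewrite ler_wpM2l ?prod_dist_ge0 //.
apply: ler_sum => i _; rewrite ler_wpM2l ?invr_ge0 //.
by apply: ler_sum => v _; rewrite ler_wpM2l ?invr_ge0.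
Qed.

Lemma mean_line_affine F c e :
  mean_line (fun x i v => c * F x i v + e) = c * mean_line F + e.
Proof.
have inner x i : \sum_v N%:R^-1 * (c * F x i v + e) =
    c * (\sum_v N%:R^-1 * F x i v) + e.
  under eq_bigr => v _ do rewrite mulrDr mulrCA.
  rewrite big_split /= -[X in X + _ = _]mulr_sumr sumr_const card_ord -mulrnAl.
  by rewrite -(mulr_natr (_^-1)) mulVf ?pnatr_eq0 // mul1r.
have middle x : \sum_i d%:R^-1 * (\sum_v N%:R^-1 * (c * F x i v + e)) =
    c * (\sum_i d%:R^-1 * (\sum_v N%:R^-1 * F x i v)) + e.
  under eq_bigr => i _ do rewrite inner mulrDr mulrCA.
  rewrite big_split /= -[X in X + _ = _]mulr_sumr sumr_const card_ord -mulrnAl.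
  by rewrite -(mulr_natr (_^-1)) mulVf ?pnatr_eq0 // mul1r.
rewrite /mean_line; under eq_bigr => x _ do rewrite middle mulrDr mulrCA.
by rewrite big_split /= -[X in X + _ = _]mulr_sumr -mulr_suml prod_dist_sum1 // mul1r.
Qed.

Lemma mean_lineE F :
  mean_line F = (d%:R * N%:R)^-1 * \sum_v \sum_i \sum_x D x * F x i v.
Proof.
transitivity (\sum_x \sum_i \sum_v (d%:R * N%:R)^-1 * (D x * F x i v)).
  apply: eq_bigr => x _; rewrite mulr_sumr; apply: eq_bigr => i _.
  by rewrite !mulr_sumr; apply: eq_bigr => v _; rewrite invfM; ring.
rewrite exchange_big /=; under eq_bigr => i _ do rewrite exchange_big /=.
rewrite exchange_big /= mulr_sumr; apply: eq_bigr => v _.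
by rewrite mulr_sumr; apply: eq_bigr => i _; rewrite mulr_sumr.
Qed.

Lemma line_round_le out q c (B : grid n d -> 'I_d -> 'I_N -> R) :
  (forall x i v s, scanning f s i (above_line x i v) n 0 ->
     prob_from D f out
       (iter q (@sample_point R) (If (NatLe 2 1) c (Halt R false))) s
     <= B x i v) ->
  forall s, prob_from D f out (line_round n d' N' a b q c) s <= mean_line B.
Proof.
move=> cB s; apply: ler_sum => x _; rewrite ler_wpM2l ?prod_dist_ge0 //.
apply: ler_sum => i _; rewrite ler_wpM2l ?invr_ge0 //.
apply: ler_sum => v _; rewrite ler_wpM2l ?invr_ge0 //.
by apply: cB; split.
Qed.

(** A union bound: [hi <= lo] at the end forces [K <= lo], no early one seen, or [hi < K], no late
    zero seen. The potential [F] sums the probabilities that either event persists. *)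
Lemma scan_far (i : 'I_d) u q c kappa K s : 0 <= kappa ->
  (forall s, prob_from D f true c s <= kappa) -> scanning f s i u n 0 ->
  prob_from D f true
    (iter q (@sample_point R) (If (NatLe 2 1) c (Halt R false))) s <=
  kappa * ((1 - early_ones (Di i) u K) ^+ q + (1 - late_zeros (Di i) u K) ^+ q).
Proof.
move=> k0 ck sc; set e := early_ones _ _ _; set l := late_zeros _ _ _.
have [w0 w1] := Di_dist i.
pose F m lo hi := kappa *
  ((1 - e) ^+ m * (K <= lo)%N%:R + (1 - l) ^+ m * (hi < K)%N%:R).
have e1 : \sum_k Di i k * (~~ (u k && (k < K)%N))%:R = 1 - e.
  rewrite -[X in _ = X - _]w1 /e /early_ones [X in _ = _ - X]big_mkcond -sumrB.
  by apply: eq_bigr => k _; case: (_ && _); rewrite ?mulr0 ?mulr1 ?subrr ?subr0.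
have l1 : \sum_k Di i k * (~~ (~~ u k && (K <= k)%N))%:R = 1 - l.
  rewrite -[X in _ = X - _]w1 /l /late_zeros [X in _ = _ - X]big_mkcond -sumrB.
  by apply: eq_bigr => k _; case: (_ && _); rewrite ?mulr0 ?mulr1 ?subrr ?subr0.
apply: (@le_trans _ _ (F q n 0%N)).
  apply: (@sample_points_le _ _ _ _ _ Di_dist true _ i u F) sc.
  - move=> {}s lo hi [_ _ slo shi _] /=; rewrite slo shi /F !expr0 !mul1r.
  case: (leqP hi lo) => [hl|_]; last by rewrite mulr_ge0 // addr_ge0.
  apply: le_trans (ck s) _; rewrite -{1}[kappa]mulr1 ler_wpM2l // -natrD ler1n.
  by case: leqP; case: leqP => //; lia.
  - move=> m lo hi; rewrite /F !exprSr -e1 -l1.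
  rewrite !mulr_sumr !mulr_suml -big_split mulr_sumr /=.
  apply: ler_sum => k _; rewrite le_eqVlt; apply/orP; left; apply/eqP.
  case: (u k) => /=; rewrite ?leq_min ?gtn_max -?leqNgt -?ltnNge;
    by case: (leqP K lo); case: (leqP K k); case: (leqP K hi) => /= _ _ _; ring.
by rewrite /F ler_wpM2l // lerD // ler_piMr ?lern1 ?leq_b1 // exprn_ge0 //
  -?e1 -?l1 sumr_ge0 // => k _; rewrite mulr_ge0.
Qed.

Lemma scan_le_kappa (i : 'I_d) u q c kappa s : 0 <= kappa ->
  (forall s, prob_from D f true c s <= kappa) -> scanning f s i u n 0 ->
  prob_from D f true
    (iter q (@sample_point R) (If (NatLe 2 1) c (Halt R false))) s <= kappa.
Proof.
move=> k0 ck.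
apply: (@sample_points_le _ _ _ _ _ Di_dist true _ i u (fun _ _ _ => kappa)).
  by move=> {}s lo hi _ /=; case: ifP.
move=> m lo hi; under eq_bigr do rewrite if_same.
by rewrite -mulr_suml; case: (Di_dist i) => _ ->; rewrite mul1r.
Qed.

Lemma expR_minus2_le : expR (- 2) <= 4^-1 :> R.
Proof.
have e1 : 2 <= expR 1 :> R by have := expR_ge1Dx (1 : R); lra.
rewrite expRN lef_pV2 ?posrE ?expR_gt0 //.
have -> : expR 2 = expR 1 * expR 1 :> R by rewrite -expRD.
by move: (expR 1) e1 => e e1; nra.
Qed.

Lemma cut_dist_le1 (i : 'I_d) u : cut_dist (Di i) u <= 1.
Proof.
have [w0 <-] := Di_dist i; apply: ler_sum => k _.
by rewrite ler_piMr //; case: (u k); case: leqP => _;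
  rewrite ?subrr ?subr0 ?sub0r ?normrN ?normr0 ?normr1.
Qed.

(** At a cut where early ones and late zeros both weigh at least half the distance, each is missed
    with probability at most [expR (- 2) <= 4^-1]. *)
Lemma scan_far_half (i : 'I_d) u q c kappa s : 0 <= kappa ->
  (forall s, prob_from D f true c s <= kappa) -> scanning f s i u n 0 ->
  4 <= q%:R * cut_dist (Di i) u ->
  prob_from D f true
    (iter q (@sample_point R) (If (NatLe 2 1) c (Halt R false))) s <= kappa / 2.
Proof.
move=> k0 ck sc q4; have [w0 w1] := Di_dist i.
have [K [eK lK]] := cut_dist_split u w0.
apply: le_trans (scan_far q K k0 ck sc) _; rewrite ler_wpM2l //.
have small t : cut_dist (Di i) u / 2 <= t -> t <= 1 -> (1 - t) ^+ q <= 4^-1.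
  move=> ht t1; apply: le_trans expR_minus2_le.
  apply: (@le_trans _ _ (expR (- t) ^+ q)).
    by rewrite lerXn2r ?nnegrE ?subr_ge0 ?expR_ge0 // -[1 - t]/(1 + - t) expR_ge1Dx.
  by rewrite -expRM_natl ler_expR; have := ler_wpM2l (ler0n R q) ht; lra.
have e1 : early_ones (Di i) u K <= 1.
  by rewrite -w1 [leRHS](bigID (fun k => u k && (k < K)%N)) /= lerDl sumr_ge0.
have l1 : late_zeros (Di i) u K <= 1.
  by rewrite -w1 [leRHS](bigID (fun k => ~~ u k && (K <= k)%N)) /= lerDl sumr_ge0.
by have := small _ eK e1; have := small _ lK l1; lra.
Qed.

(** Rounds run from [m] down to 1. Round [r] takes more than [4 * M / r] samples, enough for lines
    at distance at least [r / M]. *)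
Fixpoint tester (M m : nat) : prog R :=
  if m is r.+1 then
    line_round n d' N' a b (4 * (M %/ r.+1).+1) (tester M r)
  else Halt R true.

Lemma time_tester M m :
  (time (tester M m) <= \sum_(r < m) (40 + 28 * (M %/ r.+1)))%N.
Proof.
elim: m => [|m IHm]; first by rewrite big_ord0.
rewrite big_ord_recr; apply: leq_trans (time_line_round _ _ _ _ _ _ _) _.
by rewrite addnC leq_add //=; lia.
Qed.

(* A line at distance [>= r / M] is caught with probability [>= 1/2] by round
   [r], so the exponent counts the rounds able to catch a random line. *)
Lemma tester_accept_le M m s :
  prob_from D f true (tester M m) s <=
  expR (- (2^-1 * mean_line (fun x i v =>
    \sum_(r < m) (r.+1%:R <= M%:R * line_dist x i v)%R%:R))).
Proof.
elim: m s => [|m IHm] s.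
  rewrite [tester M 0]/= /=.
  have -> : mean_line (fun x i v =>
      \sum_(r < 0) (r.+1%:R <= M%:R * line_dist x i v)%R%:R) = 0.
    rewrite /mean_line big1 // => x _; rewrite big1 ?mulr0 // => i _.
    by rewrite big1 ?mulr0 // => v _; rewrite big_ord0 mulr0.
  by rewrite mulr0 oppr0 expR0.
set kappa := expR _ in IHm.
have k0 : 0 <= kappa by apply: expR_ge0.
pose H x i v : R := (m.+1%:R <= M%:R * line_dist x i v)%R%:R.
(* A line that this round can catch contributes at most [kappa / 2], any other at most [kappa]; the
   mean factor [1 - t] is later absorbed into [expR (- t)]. *)
apply: (@le_trans _ _ (mean_line (fun x i v => - (kappa / 2) * H x i v + kappa))).
  apply: line_round_le => // x i v {}s sc; rewrite /H.
  have [Mr|_] := leP m.+1%:R _; last first.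
    by rewrite mulr0 add0r (scan_le_kappa _ k0 IHm sc).
  apply: le_trans (scan_far_half k0 IHm sc _) _; last by rewrite mulr1; lra.
  have : M%:R <= (M %/ m.+1).+1%:R * m.+1%:R :> R.
    by rewrite -natrM ler_nat ltnW // ltn_ceil.
  have m0 : 0 < m.+1%:R :> R by rewrite ltr0n.
  have : 0 <= line_dist x i v by apply: cut_dist_ge0; case: (Di_dist i).
  rewrite natrM -/(line_dist x i v); move: Mr m0.
  move: (line_dist x i v) (M %/ m.+1).+1%:R m.+1%:R M%:R => z q r t zt r0 z0 tqr.
  suff : 1 <= q * z by lra.
  by rewrite -(ler_pM2r r0); nra.
rewrite mean_line_affine.
have -> : mean_line (fun x i v =>
    \sum_(r < m.+1) (r.+1%:R <= M%:R * line_dist x i v)%R%:R) =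
  mean_line (fun x i v =>
    \sum_(r < m) (r.+1%:R <= M%:R * line_dist x i v)%R%:R) + mean_line H.
  rewrite -big_split /=; apply: eq_bigr => x _; rewrite -mulrDr -big_split /=.
  congr (_ * _); apply: eq_bigr => i _; rewrite -mulrDr -big_split /=.
  congr (_ * _); apply: eq_bigr => v _; rewrite -mulrDr; congr (_ * _).
  by rewrite big_ord_recr.
rewrite mulrDr opprD expRD -/kappa.
rewrite (_ : _ + kappa = kappa * (1 + - (2^-1 * mean_line H))); last by ring.
by rewrite ler_wpM2l // expR_ge1Dx.
Qed.

(** Counting integers loses 1, so at least 4 rounds on average can catch the line, and acceptance
    has probability at most [expR (- 2) <= 4^-1]. *)
Lemma tester_rejects M s : 5 <= M%:R * mean_line line_dist ->
  2 / 3 <= prob_from D f false (tester M M) s.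
Proof.
move=> M5.
have acc : prob_from D f true (tester M M) s <= 4^-1.
  apply: le_trans (tester_accept_le M M s) _; apply: le_trans expR_minus2_le.
  rewrite ler_expR lerN2.
  have : M%:R * mean_line line_dist - 1 <= mean_line (fun x i v =>
      \sum_(r < M) (r.+1%:R <= M%:R * line_dist x i v)%R%:R).
    rewrite -(mean_line_affine line_dist M%:R (- 1)).
    apply: le_mean_line => x i v.
    under eq_bigr => r _ do rewrite -natr1 -lerBrDr.
    apply: count_le_ge.
    have := ler_wpM2l (ler0n R M) (cut_dist_le1 i (above_line x i v)).
    by rewrite -/(line_dist x i v); lra.
  by lra.
have := prob_fromC f (prod_dist_sum1 Di_dist) (tester M M) s; lra.
Qed.

(** The error is one-sided: thresholding a monotone line gives a step at some [K], so
    [hi <= K <= lo] persists and the test never fails. *)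
Lemma tester_monotone M m s : monotone_fun f ->
  prob_from D f false (tester M m) s <= 0.
Proof.
move=> fm; elim: m s => [|m IHm] s; first by [].
apply: (@le_trans _ _ (mean_line (fun _ _ _ => 0))); last first.
  rewrite /mean_line big1 // => x _; rewrite big1 ?mulr0 // => i _.
  by rewrite big1 ?mulr0 // => v _; rewrite mulr0.
apply: line_round_le => x i v {}s.
set u := above_line x i v => sc.
have um (k l : 'I_n) : (k <= l)%N -> u k -> u l.
  move=> kl uk; apply: le_trans uk _; apply: fm => j.
  by rewrite !ffunE; case: ifP.
pose P K := [forall k : 'I_n, (K <= k)%N ==> u k].
have Pn : P n by apply/forallP => k; rewrite leqNgt ltn_ord.
have exP : exists K, P K by exists n.
have [K Kn uK] : exists2 K, (K <= n)%N & forall k, u k = (K <= k)%N.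
  case: (ex_minnP exP) => K /forallP HK Kmin.
  exists K => [|k]; first exact: Kmin.
  apply/idP/idP => [uk|Kk]; last by have := HK k; rewrite Kk.
  by apply: Kmin; apply/forallP => l; apply/implyP => kl; apply: um uk.
pose F (m lo hi : nat) : R := (~~ ((hi <= K)%N && (K <= lo)%N))%:R.
suff : prob_from D f false (iter (4 * (M %/ m.+1).+1) (@sample_point R)
    (If (NatLe 2 1) (tester M m) (Halt R false))) s <= F 0%N n 0%N.
  by rewrite /F leq0n Kn.
apply: (@sample_points_le _ _ _ _ _ Di_dist false _ i u F _ _ _ s) sc.
  move=> {}s lo hi [_ _ slo shi _] /=; rewrite slo shi /F.
  case: (leqP hi lo) => hl; first by apply: le_trans (IHm s) _.
  by rewrite ler_nat; lia.
move=> j lo hi; have [w0 w1] := Di_dist i.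
rewrite -[leRHS]mul1r -w1 mulr_suml; apply: ler_sum => k _.
by rewrite ler_wpM2l // uK /F; case: leqP => Kk; rewrite ler_nat; lia.
Qed.

(** Replace each threshold function of [f] by a nearby monotone one, sum them and clip to [[a, b]].
    The loss [N%:R^-1] is the discretisation of thresholds; the factor [d] undoes the average over
    directions. *)
Lemma mean_line_dist_far delta : a < b -> (forall x, a <= f x <= b) ->
  (forall g, monotone_fun g -> (forall x, a <= g x <= b) ->
     delta * (b - a) < L1_dist Di f g) ->
  delta - N%:R^-1 <= 2 * d%:R * mean_line line_dist.
Proof.
move=> ab fab far; have r0 : 0 < b - a by rewrite subr_gt0.
have N0 : 0 < N%:R :> R by rewrite ltr0n.
pose h v x : R := (above v x)%:R.
pose G v i x : R := (best_cut (Di i) (above_line x i v) <= x i)%N%:R.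
have lineE x i v k : above_line (subst_coord x i k) i v = above_line x i v.
  by apply/funext => l; rewrite /above_line subst_coord2.
have Gm v i : monotone_along i (G v i).
  move=> x k l kl; rewrite /G !lineE !subst_coord_same ler_nat.
  by set e := best_cut _ _; case: (leqP e k) => // /leq_trans ->.
have GE v i : L1_dist Di (h v) (G v i) = \sum_x D x * line_dist x i v.
  rewrite /L1_dist -(expect_resample Di_dist i); apply: eq_bigr => x _.
  congr (_ * _); apply: eq_bigr => k _.
  by rewrite /G /h lineE subst_coord_same.
have /choice[g gP] v : exists g, monotone_fun g /\
    L1_dist Di (h v) g <= 2 * \sum_i \sum_x D x * line_dist x i v.
  have [g gm hg] := monotone_of_directions Di_dist (h v) (Gm v).
  by exists g; split=> //; under eq_bigr do rewrite -GE.
pose c := (b - a) / N%:R.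
have c0 : 0 < c by rewrite divr_gt0.
pose g0 x := a + c * \sum_v g v x.
pose g1 x := Num.max a (Num.min b (g0 x)).
have g0m : monotone_fun g0.
  move=> x y xy; rewrite /g0 lerD2l ler_wpM2l ?(ltW c0) //.
  by apply: ler_sum => v _; have [gm _] := gP v; apply: gm.
have g1m : monotone_fun g1.
  by move=> x y xy; rewrite /g1 !(le_max2, le_min2) // g0m.
have g1ab x : a <= g1 x <= b.
  by rewrite /g1 le_max lexx /= ge_max ge_min lexx (ltW ab).
have clip x : `|f x - g1 x| <= `|f x - g0 x|.
  rewrite /g1; have /andP[fa fb] := fab x; move: (f x) (g0 x) fa fb => s t fa fb.
  case: (leP b t) => bt.
    by rewrite (max_r (ltW ab)); do 2!case: ger0P => ?; lra.
  by case: (leP a t) => // ta; do 2!case: ger0P => ?; lra.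
(* The sum counts the integers [v < N] with [v <= z], hence lies between [z] and [z + 1]. *)
have approx x : `|f x - (a + c * \sum_v h v x)| <= c.
  pose z := (f x - a) / c.
  have fz : f x = a + c * z by rewrite /z mulrC divfK ?gt_eqF //; ring.
  have hz v : h v x = (v%:R <= z)%R%:R.
    by rewrite /h /above -/c /z ler_pdivlMr // lerBrDr.
  have /andP[fa fb] := fab x.
  have z0 : 0 <= z by rewrite divr_ge0 ?subr_ge0 // ltW.
  have zN : z <= N%:R.
    by rewrite ler_pdivrMr // /c mulrC divfK ?gt_eqF // lerD2r.
  under eq_bigr do rewrite hz.
  have := count_le_ge zN; have := count_le_le N z0.
  rewrite {1}fz; move: (\sum_(v < _) _) => S S1 S2.
  rewrite (_ : a + c * z - (a + c * S) = c * (z - S)); last by ring.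
  rewrite normrM gtr0_norm // ler_piMr ?(ltW c0) //.
  by case: ger0P => ?; lra.
have pt x : `|f x - g1 x| <= c + c * \sum_v `|h v x - g v x|.
  apply: le_trans (clip x) _.
  apply: le_trans (ler_distD (a + c * \sum_v h v x) _ _) _.
  apply: lerD => //; rewrite /g0 opprD addrACA subrr add0r -mulrBr -sumrB.
  rewrite normrM gtr0_norm // ler_wpM2l ?(ltW c0) //; exact: ler_norm_sum.
have ub : L1_dist Di f g1 <= c + c * \sum_v L1_dist Di (h v) (g v).
  apply: (@le_trans _ _ (\sum_x D x * (c + c * \sum_v `|h v x - g v x|))).
    by apply: ler_sum => x _; rewrite ler_wpM2l ?prod_dist_ge0.
  have affE (T : grid n d -> R) :
      \sum_x D x * (c + c * T x) = c + c * \sum_x D x * T x.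
    transitivity ((\sum_x D x) * c + c * \sum_x D x * T x).
      rewrite mulr_suml mulr_sumr -big_split /=.
      by apply: eq_bigr => x _; ring.
    by rewrite prod_dist_sum1 // mul1r.
  rewrite affE lerD2l ler_wpM2l ?(ltW c0) // [leRHS]exchange_big /=.
  by apply: ler_sum => x _; rewrite mulr_sumr.
have ub2 : \sum_v L1_dist Di (h v) (g v) <=
    2 * (d%:R * N%:R * mean_line line_dist).
  rewrite mean_lineE mulVKf ?mulf_neq0 ?pnatr_eq0 // mulr_sumr.
  by apply: ler_sum => v _; case: (gP v).
have := far g1 g1m g1ab => lt1.
have H : delta * (b - a) <= c + c * (2 * (d%:R * N%:R * mean_line line_dist)).
  apply: ltW; apply: lt_le_trans lt1 _; apply: le_trans ub _.
  by rewrite lerD2l ler_wpM2l // ltW.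
rewrite -(ler_pM2r r0).
have -> : (delta - N%:R^-1) * (b - a) = delta * (b - a) - c by rewrite /c; ring.
rewrite lerBlDl; apply: le_trans H _; rewrite lerD2l le_eqVlt; apply/orP; left.
by apply/eqP; rewrite /c; field; rewrite nat1r pnatr_eq0.
Qed.

End Tester.

(** Any admissible [g] bounds the infimum from above. For [p = 2], square and use
    [|f - g|^2 <= (b - a) |f - g|]. *)
Lemma L1_far_of_Lp_far (R : realType) n d (Di : 'I_d -> 'I_n -> R)
    (a b p eps : R) (f g : grid n d -> R) :
  (forall i, is_dist (Di i)) -> a < b -> p = 1 \/ p = 2 -> 0 < eps ->
  (forall x, a <= f x <= b) -> (forall x, a <= g x <= b) -> monotone_fun g ->
  eps < Lp_dist a b p (prod_dist Di) (@monotone_fun R n d) f ->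
  eps `^ p * (b - a) < L1_dist Di f g.
Proof.
move=> Di_dist ab p12 e0 fab gab gm; rewrite /Lp_dist.
have r0 : 0 < b - a by rewrite subr_gt0.
rewrite mulrC ltr_pdivlMr // => far.
have {far} : eps * (b - a) <
    expect (prod_dist Di) (fun x => `|f x - g x| `^ p) `^ Num.min p^-1 1.
  apply: lt_le_trans far _; apply: ge_inf; last by exists g.
  by exists 0 => _ [h _ <-]; apply: powR_ge0.
have E0 (F : grid n d -> R) : (forall x, 0 <= F x) ->
    0 <= expect (prod_dist Di) F.
  by move=> F0; apply: sumr_ge0 => x _; rewrite mulr_ge0 ?prod_dist_ge0.
case: p12 => ->.
  rewrite invr1 minxx !powRr1 ?(ltW e0) //; last first.
    by apply: E0 => x; apply: powR_ge0.
  rewrite (_ : expect _ _ = L1_dist Di f g) //.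
  by apply: eq_bigr => x _; rewrite powRr1.
rewrite min_l; last by rewrite invf_le1 ?ler1n.
rewrite powR12_sqrt; last by apply: E0 => x; apply: powR_ge0.
rewrite (powR_mulrn 2) ?(ltW e0) //.
set E := expect _ _ => lt_sqrt.
have EE : E <= (b - a) * L1_dist Di f g.
  rewrite /E /expect /L1_dist mulr_sumr; apply: ler_sum => x _.
  rewrite mulrCA ler_wpM2l ?prod_dist_ge0 // (powR_mulrn 2) // expr2.
  rewrite ler_wpM2r //; have /andP[? ?] := fab x; have /andP[? ?] := gab x.
  by case: ger0P => ?; lra.
have : (eps * (b - a)) ^+ 2 < E.
  rewrite -(@sqr_sqrtr _ E); last by apply: E0 => x; apply: powR_ge0.
  by rewrite ltr_pXn2r // nnegrE ?sqrtr_ge0 // mulr_ge0 // ltW.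
move/lt_le_trans/(_ EE).
by rewrite exprMn [(b - a) ^+ 2]expr2 mulrA [X in _ < X]mulrC ltr_pM2r.
Qed.

(** * Harmonic sums and the running time *)

Section Harmonic.
Variable R : realType.

(** Induction: [ln (1 - t) <= - t] at [t = 1 / (m + 1)] gives [1 / (m + 1) <= ln ((m + 1) / m)]. *)
Lemma harmonic_le m : (0 < m)%N ->
  \sum_(r < m) r.+1%:R^-1 <= 1 + ln m%:R :> R.
Proof.
case: m => // m _; elim: m => [|m IHm].
  by rewrite big_ord_recr big_ord0 /= ln1 add0r addr0 invr1.
rewrite big_ord_recr /=; apply: le_trans (lerD IHm (lexx _)) _.
have m1 : 0 < m.+1%:R :> R by rewrite ltr0n.
have m2 : 0 < m.+2%:R :> R by rewrite ltr0n.
have m2E : m.+2%:R = m.+1%:R + 1 :> R by rewrite natr1.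
rewrite -addrA lerD2l -lerBrDl -ln_div ?posrE //.
have : ln (1 + - m.+2%:R^-1) <= - m.+2%:R^-1 :> R.
  by apply: le_ln1Dx; rewrite ltrN2 invf_lt1 // ltr1n.
have -> : 1 + - m.+2%:R^-1 = (m.+2%:R / m.+1%:R)^-1 :> R.
  rewrite m2E; move: (m.+1%:R) m1 => t t0.
  by field; apply/andP; split; rewrite gt_eqF //; lra.
by rewrite lnV ?posrE ?divr_gt0 // lerN2.
Qed.

Lemma sum_divn_le M : (0 < M)%N ->
  (\sum_(r < M) M %/ r.+1)%N%:R <= M%:R * (1 + ln M%:R) :> R.
Proof.
move=> M0; apply: le_trans (ler_wpM2l (ler0n R M) (harmonic_le M0)).
rewrite natr_sum mulr_sumr; apply: ler_sum => r _.
by rewrite ler_pdivlMr ?ltr0n // -natrM ler_nat leq_divM.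
Qed.

(** The total is at most [M (68 + 28 ln M)]. From [21 <= 2 ^ 5] and [X >= 2], [ln M <= 6 ln X]; from
    [ln X >= 1 / 2], [68 <= 136 ln X]; and [136 + 28 * 6 = 304]. *)
Lemma round_budget (X : R) M T : 2 <= X -> M%:R <= 21 * X ->
  (0 < M)%N -> (T <= \sum_(r < M) (40 + 28 * (M %/ r.+1)))%N ->
  T%:R <= 21 * 304 * (X * ln X).
Proof.
move=> X2 MX M0; rewrite big_split sum_nat_const card_ord -big_distrr /=.
rewrite -(ler_nat R) natrD !natrM => TM.
have TM' := le_trans TM (lerD (lexx _) (ler_wpM2l (ler0n R 28) (sum_divn_le M0))).
have X0 : 0 < X by lra.
have MR : 0 < M%:R :> R by rewrite ltr0n.
have ln2 : 2^-1 <= ln 2 :> R.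
  have : ln (1 + - 2^-1) <= - 2^-1 :> R by apply: le_ln1Dx; lra.
  by rewrite (_ : 1 + - 2^-1 = 2^-1 :> R) ?lnV ?posrE // ?lerN2 //; lra.
have lnX2 : ln 2 <= ln X by rewrite ler_ln ?posrE.
have lnM : ln M%:R <= 5 * ln 2 + ln X.
  have -> : 5 * ln 2 + ln X = ln (2 ^+ 5 * X).
    by rewrite lnM ?posrE ?exprn_gt0 // lnXn // mulr_natl.
  rewrite ler_ln ?posrE ?mulr_gt0 ?exprn_gt0 //; apply: le_trans MX _.
  by rewrite ler_wpM2r ?(ltW X0) // -natrX ler_nat.
apply: le_trans TM' _.
apply: (@le_trans _ _ (M%:R * (304 * ln X))).
  rewrite [leLHS](_ : _ = M%:R * (68 + 28 * ln M%:R)); last by ring.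
  by rewrite ler_wpM2l //; lra.
rewrite mulrACA ler_wpM2r // mulr_ge0 ?ler0n //; lra.
Qed.

End Harmonic.

Theorem mainTheorem1 (R : realType) :
  exists2 C : R, 0 < C &
  forall (n d : nat) (n_gt0 : (0 < n)%N) (d_gt0 : (0 < d)%N)
    (a b p eps : R) (Di : 'I_d -> 'I_n -> R),
    a < b -> p = 1 \/ p = 2 -> 0 < eps < 1 ->
    (forall i, is_dist (Di i)) ->
    exists2 T : prog R,
      Lp_tester n_gt0 a b p eps (prod_dist Di) (@monotone_fun R n d) T &
      (time T)%:R <= C * (d%:R / eps `^ p * ln (d%:R / eps `^ p)).
Proof.
exists (21 * 304) => [|n [//|d']]; first by rewrite mulr_gt0 ?ltr0n.
move=> n_gt0 _ a b p eps Di ab p12 /andP[e0 e1] Di_dist.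
set delta := eps `^ p.
have delta0 : 0 < delta by apply: powR_gt0.
have r0 : 0 < b - a by rewrite subr_gt0.
have dge1 : 1 <= d'.+1%:R :> R by rewrite ler1n.
have [dhalf|dhalf] := leP 2^-1 delta.
  exists (Halt R true); last first.
    (* The time is 0, so only nonnegativity of the bound is needed, that is, [d / delta >= 1]. *)
    have delta1 : delta <= 1.
      rewrite /delta; case: p12 => ->; first by rewrite powRr1 ltW.
      by rewrite (powR_mulrn 2) ?exprn_ile1 ?(ltW e0) ?(ltW e1).
    have X1 : 1 <= d'.+1%:R / delta.
      by rewrite ler_pdivlMr // mul1r (le_trans delta1).
    rewrite /= mulr_ge0 ?(mulr_ge0 (ler0n _ _) (ler0n _ _)) //.
    by rewrite mulr_ge0 ?ln_ge0 // (le_trans _ X1).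
  move=> f fab; split=> [_|far]; first by rewrite /prob_output /=; lra.
  exfalso.
  pose g (_ : grid n d'.+1) : R := (a + b) / 2.
  have gab x : a <= g x <= b by rewrite /g; apply/andP; split; lra.
  have gm : monotone_fun g by [].
  have := L1_far_of_Lp_far Di_dist ab p12 e0 fab gab gm far; rewrite -/delta.
  apply/negP; rewrite -leNgt.
  apply: (@le_trans _ _ ((b - a) / 2)); last by nra.
  have -> : (b - a) / 2 = \sum_x prod_dist Di x * ((b - a) / 2).
    by rewrite -mulr_suml prod_dist_sum1 // mul1r.
  apply: ler_sum => x _; rewrite ler_wpM2l ?prod_dist_ge0 // /g.
  by have /andP[fa fb] := fab x; case: ger0P => ?; lra.
set X := d'.+1%:R / delta.
have X2 : 2 <= X by rewrite ler_pdivlMr //; lra.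
(* [N] is both the number of rounds and of thresholds. As [N > 20 X], [1 / N <= delta / 2], so lines
   have mean distance at least [1 / (4 X)] and [N] times it is at least 5; also [N <= 21 X]. *)
pose N' := Num.truncn (20 * X); pose N := N'.+1.
have /andP[N1 N2] : N'%:R <= 20 * X < N%:R by apply: truncn_itv; lra.
exists (tester n d' N' a b N N); last first.
  apply: (round_budget X2 _ _ (time_tester _ _ _ _ _ _ _)) => //.
  by rewrite (_ : N%:R = N'%:R + 1) ?natr1 //; lra.
move=> f fab; split=> [fm|far].
  rewrite /prob_output; set T := tester _ _ _ _ _ _ _; set s := init_state _ _ _.
  have := tester_monotone N' a b Di_dist N N s fm.
  have := prob_fromC f (prod_dist_sum1 Di_dist) T s; rewrite -/T.
  by move: (prob_from _ _ true _ _) (prob_from _ _ false _ _) => t u; lra.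
apply: tester_rejects => //.
have := mean_line_dist_far N' Di_dist ab fab (fun g gm gab =>
  L1_far_of_Lp_far Di_dist ab p12 e0 fab gab gm far).
rewrite -/delta -/N; set m := mean_line _ _ => H.
have XE : d'.+1%:R = X * delta by rewrite /X divfK ?gt_eqF.
rewrite XE in H.
have N0 : 0 < N%:R :> R by rewrite ltr0n.
have N3 : N%:R^-1 <= delta / 2.
  rewrite -[leLHS]mul1r ler_pdivrMr //.
  by have := dge1; rewrite XE; nra.
have Xm : 4^-1 <= X * m.
  by rewrite -(ler_pM2r delta0); nra.
by nra.
Qed.
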